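(* For any $d\in\mathbb{R}$, any real $x\ge 0$ with $x>-d$, and any $c\in[0,1]$, we have $$\frac{\Pi(x)}{S_d(x)} = \exp\left(\int_{1/2}^{\infty}\frac{\frac12-\{t\}}{x+t}\,dt+\int_{1/2}^{d}\frac{t-\frac12}{x+t}\,dt\right) = \exp\left(\int_{d}^{\infty}\frac{\frac12-\{t\}}{x+t}\,dt+\int_{c}^{d}\frac{\lfloor t\rfloor}{x+t}\,dt\right),$$ which for $d\in[0,1]$ and real $x\ge0$ with $x>-d$ simplifies to $$\frac{\Pi(x)}{S_d(x)} = \exp\left(\int_{d}^{\infty}\frac{\frac12-\{t\}}{x+t}\,dt\right).$$
   Context: $\Pi(x) := \Gamma(x+1)$ for real $x\ge 0$, with $\Gamma$ Euler's gamma function. For $d\in\mathbb{R}$ and real $x>-d$, $S_d(x) := \sqrt{2\pi}\,e^{-d}\,(x+d)^{x+\frac12}\,e^{-x}$. For $t\in\mathbb{R}$, $\lfloor t\rfloor$ is the floor and $\{t\}:=t-\lfloor t\rfloor\in[0,1)$ the fractional part. Integrals over bounded intervals are oriented, $\int_a^b=-\int_b^a$, and the value of an integrand at a single point (e.g. at $t=0$ when $x=0$) is irrelevant. Integrals over unbounded intervals are improper integrals, $\int_a^\infty f(t)\,dt=\lim_{T\to\infty}\int_a^T f(t)\,dt$ (existence of the limit being part of the assertion). *)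

(* Defs.v *)
From Stdlib Require Export Reals.
From Coquelicot Require Export Coquelicot.
Open Scope R_scope.

(* Euler's integral of the second kind, improper at both ends.  It converges
   exactly for s > 0, which is the only range of intended use. *)
Definition Gamma (s : R) : R :=
  RInt_gen (fun t => Rpower t (s - 1) * exp (- t))
           (at_right 0) (Rbar_locally p_infty).

(* Gauss's notation for the shifted gamma function. *)
Definition GPi (x : R) : R := Gamma (x + 1).

(* Only meaningful for x + d > 0, because of [Rpower]. *)
Definition S_ (d x : R) : R :=
  sqrt (2 * PI) * exp (- d) * Rpower (x + d) (x + 1 / 2) * exp (- x).

(* The limit of RInt f a T as T tends to +oo, with f integrable on [a, T] for
   all large T.  [RInt_infty] carries information only under [ex_RInt_infty]. *)
Definition ex_RInt_infty (f : R -> R) (a : R) : Prop :=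
  ex_RInt_gen f (at_point a) (Rbar_locally p_infty).

Definition RInt_infty (f : R -> R) (a : R) : R :=
  RInt_gen f (at_point a) (Rbar_locally p_infty).

(* [Int_part] is [up t - 1], the floor also for negative t, and [frac_part t]
   is [t - IZR (Int_part t)].  When x = 0 these integrands take a meaningless
   total-division value at t = 0, which no integral sees. *)
Definition saw_kernel (x t : R) : R := (1 / 2 - frac_part t) / (x + t).
Definition lin_kernel (x t : R) : R := (t - 1 / 2) / (x + t).
Definition floor_kernel (x t : R) : R := IZR (Int_part t) / (x + t).

(* Main.v *)
Require Import Defs.
From Stdlib Require Import ZArith Reals Lra Lia Classical.
From Coquelicot Require Import Coquelicot.
Open Scope R_scope.

(** Write [rho y = GPi y / S_ 0 y]. The functional equation
    [GPi (y + 1) = (y + 1) * GPi y] gives, for [y = x + k] with [k] an integer,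
    [rho y = rho (y + 1) * exp ((y + 1/2) * (ln (y + 1) - ln y) - 1)], and the
    exponent is exactly the integral of [saw_kernel x] over the cell from [k] to
    [k + 1]. Telescoping ([stirling_ratio_saw]) leads to
    [rho (x + 1) = rho (x + 1 + n) * exp (integral of saw_kernel x from 1 to 1 + n)].
    Let [n] tend to infinity: the integral converges, and Stirling's formula says
    that [rho] tends to 1. As [rho (x + 1) = GPi x / S_ 1 x], this is the case
    [d = 1] ([GPi_div_S_1]).

    Convergence of the integral comes from integration by parts with the bounded
    periodic primitive [frac_part t * (1 - frac_part t) / 2] of the sawtooth, done
    cell by cell ([saw_integral_hump]).

    Stirling's formula is obtained in two steps. Along the integers, the telescoped
    identity with [x = 0] already shows that [rho n] has a positive limit, and the
    Wallis integrals identify this limit as 1 ([stirling_factorial]). Between the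
    integers, comparing [t ^ s] with its tangent inside Euler's integral gives
    [rho (y + s) <= (1 + s / y) * rho y] for [s] between 0 and 1
    ([stirling_ratio_add_le]), which squeezes [rho (n + s)] between values of [rho]
    at integers ([stirling_GPi]).

    Passing from [d = 1] to another [d] is elementary: [S_ 1 x / S_ d x] is the
    exponential of the integral of [lin_kernel x] from 1 to [d], and
    [saw_kernel x + lin_kernel x = floor_kernel x] vanishes between 0 and 1, so the
    starting points 1/2, 1 and [c] may be exchanged. *)

(** * Integrals of positive functions over the half-line *)

Lemma at_right_0_lt (b : R) : 0 < b -> at_right 0 (fun a => 0 < a < b).
Proof.
  intro Hb. exists (mkposreal b Hb). intros y Hy Hy0.
  apply Rabs_lt_between in Hy. unfold minus, plus, opp in Hy; simpl in Hy. lra.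
Qed.

(** For a nonnegative integrand the integrals over compact intervals grow with
    the interval, so they converge to their supremum at both ends at once. *)
Lemma ex_RInt_gen_pos_bounded (f : R -> R) (M : R) :
  (forall t, 0 < t -> continuous f t) ->
  (forall t, 0 < t -> 0 <= f t) ->
  (forall a b, 0 < a <= b -> RInt f a b <= M) ->
  ex_RInt_gen f (at_right 0) (Rbar_locally p_infty).
Proof.
  intros Hc Hp HM.
  assert (Hex : forall a b, 0 < a <= b -> ex_RInt f a b).
  { intros a b Hab. apply (ex_RInt_continuous f). intros z Hz.
    rewrite Rmin_left in Hz by lra. apply Hc; lra. }
  assert (Hmon : forall a b a' b', 0 < a' <= a -> a <= b -> b <= b' ->
            RInt f a b <= RInt f a' b').
  { intros a b a' b' Ha Hab Hb.
    assert (E : RInt f a' b' = RInt f a' a + RInt f a b + RInt f b b').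
    { rewrite <- (RInt_Chasles f a' b b'), <- (RInt_Chasles f a' a b);
        try (apply Hex; lra). reflexivity. }
    rewrite E.
    assert (0 <= RInt f a' a)
      by (apply RInt_ge_0; [lra | apply Hex; lra | intros; apply Hp; lra]).
    assert (0 <= RInt f b b')
      by (apply RInt_ge_0; [lra | apply Hex; lra | intros; apply Hp; lra]).
    lra. }
  destruct (completeness (fun v => exists a b, 0 < a <= b /\ v = RInt f a b))
    as [l [Hub Hlub]].
  { exists M. intros v (a & b & Hab & ->). now apply HM. }
  { exists (RInt f 1 1), 1, 1. split; [lra | reflexivity]. }
  exists l. intros P [eps HP].
  destruct (classic (exists a b, 0 < a <= b /\ l - eps < RInt f a b))
    as [(a & b & Hab & Hl) | Hno].
  - unfold filtermapi.
    apply (Filter_prod _ _ _ (fun u => 0 < u < a) (fun v => b < v)).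
    + apply at_right_0_lt, Hab.
    + exists b. intros v Hv; exact Hv.
    + intros u v Hu Hv. exists (RInt f u v). split.
      * simpl. apply (RInt_correct f). apply Hex. lra.
      * apply HP. apply Rabs_lt_between. unfold minus, plus, opp; simpl.
        assert (RInt f a b <= RInt f u v) by (apply Hmon; lra).
        assert (RInt f u v <= l)
          by (apply Hub; exists u, v; split; [lra | reflexivity]).
        destruct eps as [e He]; simpl in *. lra.
  - exfalso. assert (l <= l - eps).
    { apply Hlub. intros v (a & b & Hab & ->).
      apply Rnot_lt_le. intro H. apply Hno. exists a, b. auto. }
    destruct eps as [e He]; simpl in *; lra.
Qed.

(** * Euler's integral and its functional equation *)

Definition gamma_kernel (x t : R) : R := Rpower t x * exp (- t).

Lemma GPi_eq_RInt_gen (x : R) :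
  GPi x = RInt_gen (gamma_kernel x) (at_right 0) (Rbar_locally p_infty).
Proof.
  unfold GPi, Gamma, gamma_kernel. now replace (x + 1 - 1) with x by ring.
Qed.

Lemma gamma_kernel_continuous (x t : R) : 0 < t -> continuous (gamma_kernel x) t.
Proof.
  intro Ht. apply (ex_derive_continuous (gamma_kernel x)).
  unfold gamma_kernel, Rpower. auto_derive. exact Ht.
Qed.

Lemma gamma_kernel_pos (x t : R) : 0 < gamma_kernel x t.
Proof. apply Rmult_lt_0_compat; apply exp_pos. Qed.

Lemma exp_le (u v : R) : u <= v -> exp u <= exp v.
Proof.
  intros [H | ->]; [left; now apply exp_increasing | apply Rle_refl].
Qed.

Lemma ln_le_sub_1 (u : R) : 0 < u -> ln u <= u - 1.
Proof.
  intro Hu. generalize (exp_ineq1_le (ln u)). rewrite exp_ln by exact Hu. lra.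
Qed.

(** One exponential half of the decay is kept for integrability, the other half
    absorbs the power: [ln t <= t / (2 * (x + 1)) + ln (2 * (x + 1))], and the
    factor [x / (2 * (x + 1))] stays below [1 / 2] uniformly down to [x = 0]. *)
Lemma gamma_kernel_le_exp (x t : R) : 0 <= x -> 0 < t ->
  gamma_kernel x t <= exp (x * ln (2 * (x + 1))) * exp (- t / 2).
Proof.
  intros Hx Ht. unfold gamma_kernel, Rpower. rewrite <- !exp_plus.
  assert (Hl : ln t <= t / (2 * (x + 1)) + ln (2 * (x + 1))).
  { replace (ln t) with (ln (t / (2 * (x + 1))) + ln (2 * (x + 1))).
    - assert (0 < t / (2 * (x + 1))) by (apply Rdiv_lt_0_compat; lra).
      generalize (ln_le_sub_1 _ H). lra.
    - rewrite <- ln_mult; [f_equal; field; lra | apply Rdiv_lt_0_compat; lra | lra]. }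
  assert (Ht2 : x * (t / (2 * (x + 1))) <= t / 2).
  { replace (t / 2) with (x * (t / (2 * (x + 1))) + t / (2 * (x + 1)))
      by (field; lra).
    assert (0 < t / (2 * (x + 1))) by (apply Rdiv_lt_0_compat; lra). lra. }
  assert (Hxl : x * ln t <= x * (t / (2 * (x + 1)) + ln (2 * (x + 1))))
    by (apply Rmult_le_compat_l; lra).
  apply exp_le. lra.
Qed.

Lemma ex_gamma_integral (x : R) : 0 <= x ->
  ex_RInt_gen (gamma_kernel x) (at_right 0) (Rbar_locally p_infty).
Proof.
  intro Hx. set (C := exp (x * ln (2 * (x + 1)))).
  apply (ex_RInt_gen_pos_bounded _ (2 * C)).
  - apply gamma_kernel_continuous.
  - intros t _. apply Rlt_le, gamma_kernel_pos.
  - intros a b Hab.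
    assert (HI : is_RInt (fun t => C * exp (- t / 2)) a b
              (- 2 * C * exp (- b / 2) - - 2 * C * exp (- a / 2))).
    { apply (is_RInt_derive (fun t => - 2 * C * exp (- t / 2))).
      - intros t _. auto_derive; [exact I | unfold Rdiv; field].
      - intros t _. apply (ex_derive_continuous (fun t => C * exp (- t / 2))).
        auto_derive. exact I. }
    apply Rle_trans with (- 2 * C * exp (- b / 2) - - 2 * C * exp (- a / 2)).
    + apply (is_RInt_le (gamma_kernel x) (fun t => C * exp (- t / 2)) a b).
      * lra.
      * apply (RInt_correct (gamma_kernel x)).
        apply (ex_RInt_continuous (gamma_kernel x)). intros z Hz.
        rewrite Rmin_left in Hz by lra. apply gamma_kernel_continuous; lra.
      * exact HI.
      * intros t Ht. apply gamma_kernel_le_exp; lra.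
    + assert (0 < C) by apply exp_pos.
      assert (exp (- a / 2) <= 1).
      { rewrite <- exp_0. left. apply exp_increasing. lra. }
      assert (0 < exp (- b / 2)) by apply exp_pos.
      nra.
Qed.

Lemma is_gamma_integral (x : R) : 0 <= x ->
  is_RInt_gen (gamma_kernel x) (at_right 0) (Rbar_locally p_infty) (GPi x).
Proof.
  intro Hx. rewrite GPi_eq_RInt_gen.
  apply (RInt_gen_correct (gamma_kernel x)), (ex_gamma_integral x Hx).
Qed.

(** Turns a property of all compact subintervals of the open half-line into
    one that holds eventually for both improper ends. *)
Lemma filter_prod_pos (P : R * R -> Prop) :
  (forall a b, 0 < a <= b -> P (a, b)) ->
  filter_prod (at_right 0) (Rbar_locally p_infty) P.
Proof.
  intro H. apply (Filter_prod _ _ _ (fun a => 0 < a < 1) (fun b => 1 < b)).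
  - apply at_right_0_lt, Rlt_0_1.
  - exists 1. intros v Hv; exact Hv.
  - intros a b Ha Hb. apply H. lra.
Qed.

(** The absolute value makes nonnegativity of an integral the special case
    [f = g]. *)
Lemma RInt_gen_pos_le (f g : R -> R) (If Ig : R) :
  (forall t, 0 < t -> 0 <= f t <= g t) ->
  is_RInt_gen f (at_right 0) (Rbar_locally p_infty) If ->
  is_RInt_gen g (at_right 0) (Rbar_locally p_infty) Ig ->
  Rabs If <= Ig.
Proof.
  intros H Hf Hg.
  apply (RInt_gen_norm (Fa := at_right 0) (Fb := Rbar_locally p_infty) f g).
  - apply filter_prod_pos. simpl. intros; lra.
  - apply filter_prod_pos. simpl. intros a b Hab t Ht.
    change (norm (f t)) with (Rabs (f t)). rewrite Rabs_pos_eq; apply H; lra.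
  - exact Hf.
  - exact Hg.
Qed.

Lemma exp_half_lim : filterlim (fun t => exp (- t / 2)) (Rbar_locally p_infty) (locally 0).
Proof.
  change (is_lim (fun t => exp (- t / 2)) p_infty 0).
  apply (is_lim_comp exp (fun t => - t / 2) p_infty 0 m_infty).
  - apply is_lim_exp_m.
  - apply (is_lim_ext (fun t => (- / 2) * t)); [intro; field|].
    replace m_infty with (Rbar_mult (- / 2) p_infty).
    + apply is_lim_scal_l, is_lim_id.
    + simpl. destruct Rle_dec as [H|H]; [exfalso; lra | reflexivity].
  - now exists 0.
Qed.

Lemma gamma_kernel_lim_infty (x : R) : 0 <= x ->
  filterlim (gamma_kernel x) (Rbar_locally p_infty) (locally 0).
Proof.
  intro Hx.
  apply (filterlim_le_le (F := Rbar_locally p_infty) (fun _ => 0) (gamma_kernel x)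
           (fun t => exp (x * ln (2 * (x + 1))) * exp (- t / 2)) (Finite 0)).
  - exists 0. intros t Ht. split; [apply Rlt_le, gamma_kernel_pos|].
    now apply gamma_kernel_le_exp.
  - apply filterlim_const.
  - replace (Rbar_locally 0)
      with (Rbar_locally (Rbar_mult (exp (x * ln (2 * (x + 1)))) 0))
      by (simpl; now rewrite Rmult_0_r).
    apply (is_lim_scal_l (fun t => exp (- t / 2)) _ p_infty 0). exact exp_half_lim.
Qed.

Lemma gamma_kernel_succ_lim_0 (x : R) : 0 <= x ->
  filterlim (gamma_kernel (x + 1)) (at_right 0) (locally 0).
Proof.
  intro Hx.
  apply (filterlim_le_le (F := at_right 0) (fun _ => 0) (gamma_kernel (x + 1))
           (fun t => t) (Finite 0)).
  - apply (filter_imp (fun t => 0 < t < 1)); [|apply at_right_0_lt, Rlt_0_1].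
    intros t [Ht0 Ht1]. split; [apply Rlt_le, gamma_kernel_pos|].
    unfold gamma_kernel. rewrite Rpower_plus, Rpower_1 by lra.
    assert (Rpower t x <= 1).
    { unfold Rpower. rewrite <- exp_0. apply exp_le.
      generalize (ln_le_sub_1 t Ht0). intro. nra. }
    assert (exp (- t) <= 1) by (rewrite <- exp_0; apply exp_le; lra).
    assert (0 < Rpower t x) by apply exp_pos.
    assert (0 < exp (- t)) by apply exp_pos.
    assert (Rpower t x * t <= t) by nra. nra.
  - apply filterlim_const.
  - intros P [e HP]. exists e. intros t Ht _. now apply HP.
Qed.

Lemma is_RInt_gen_pos_derive (f df : R -> R) (la lb : R) :
  (forall t, 0 < t -> is_derive f t (df t)) ->
  (forall t, 0 < t -> continuous df t) ->
  filterlim f (at_right 0) (locally la) ->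
  filterlim f (Rbar_locally p_infty) (locally lb) ->
  is_RInt_gen df (at_right 0) (Rbar_locally p_infty) (lb - la).
Proof.
  intros Hd Hc Ha Hb.
  apply (is_RInt_gen_ext (Derive f)).
  { apply filter_prod_pos. simpl. intros a b Hab t Ht.
    rewrite Rmin_left in Ht by lra. apply is_derive_unique, Hd. lra. }
  apply is_RInt_gen_Derive; trivial.
  - apply filter_prod_pos. simpl. intros a b Hab t Ht.
    rewrite Rmin_left in Ht by lra. exists (df t). apply Hd. lra.
  - apply filter_prod_pos. simpl. intros a b Hab t Ht.
    rewrite Rmin_left in Ht by lra.
    apply (continuous_ext_loc _ df); [|apply Hc; lra].
    apply (filter_imp (fun y => 0 < y)); [|apply open_gt; lra].
    intros y Hy. symmetry. now apply is_derive_unique, Hd.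
Qed.

(** Integration by parts, as the statement that the derivative of
    [t ^ (x + 1) * exp (- t)], whose limits at both ends vanish, has integral 0. *)
Lemma GPi_succ (x : R) : 0 <= x -> GPi (x + 1) = (x + 1) * GPi x.
Proof.
  intro Hx.
  set (df := fun t => (x + 1) * gamma_kernel x t - gamma_kernel (x + 1) t).
  assert (H0 : is_RInt_gen df (at_right 0) (Rbar_locally p_infty) (0 - 0)).
  { apply (is_RInt_gen_pos_derive (gamma_kernel (x + 1))).
    - intros t Ht. unfold df, gamma_kernel.
      rewrite (Rpower_plus x 1 t), (Rpower_1 t Ht).
      apply (is_derive_ext_loc (fun t => Rpower t x * t * exp (- t))).
      + apply (filter_imp (fun y => 0 < y)); [|now apply open_gt].
        intros y Hy. now rewrite Rpower_plus, Rpower_1.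
      + unfold Rpower. auto_derive; [exact Ht | field; lra].
    - intros t Ht. unfold df. apply (continuous_minus (V := R_NormedModule)).
      + apply (continuous_scal_r (V := R_NormedModule) (x + 1)).
        now apply gamma_kernel_continuous.
      + now apply gamma_kernel_continuous.
    - now apply gamma_kernel_succ_lim_0.
    - apply gamma_kernel_lim_infty. lra. }
  assert (H1 : is_RInt_gen df (at_right 0) (Rbar_locally p_infty)
                 ((x + 1) * GPi x - GPi (x + 1))).
  { apply (is_RInt_gen_minus (V := R_NormedModule)
             (fun t => (x + 1) * gamma_kernel x t) (gamma_kernel (x + 1))).
    - apply (is_RInt_gen_scal (V := R_NormedModule) (gamma_kernel x)).
      now apply is_gamma_integral.
    - apply is_gamma_integral. lra. }
  apply (is_RInt_gen_unique df) in H0. apply (is_RInt_gen_unique df) in H1.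
  rewrite H0 in H1. lra.
Qed.

Lemma GPi_0 : GPi 0 = 1.
Proof.
  assert (E : forall t, gamma_kernel 0 t = exp (- t)).
  { intro t. unfold gamma_kernel, Rpower. rewrite Rmult_0_l, exp_0. ring. }
  rewrite GPi_eq_RInt_gen. apply (is_RInt_gen_unique (gamma_kernel 0)).
  replace 1 with (- 0 - - 1) by ring.
  apply (is_RInt_gen_pos_derive (fun t => - gamma_kernel 0 t)).
  - intros t _. rewrite E. apply (is_derive_ext (fun t => - exp (- t))).
    + intro u. now rewrite E.
    + auto_derive; [exact I | ring].
  - intros t Ht. now apply gamma_kernel_continuous.
  - apply (filterlim_ext (fun t => - exp (- t))); [intro t; now rewrite E|].
    assert (Hc : continuous (fun t => - exp (- t)) 0).
    { apply (ex_derive_continuous (fun t => - exp (- t))). auto_derive. exact I. }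
    unfold continuous in Hc. rewrite Ropp_0, exp_0 in Hc.
    intros P HP. destruct (Hc P HP) as [e He]. exists e. intros t Ht _. now apply He.
  - apply (filterlim_comp _ _ _ (gamma_kernel 0) Ropp _ (locally 0)).
    + apply gamma_kernel_lim_infty. lra.
    + apply (filterlim_opp (V := R_NormedModule) 0).
Qed.

Lemma GPi_INR (n : nat) : GPi (INR n) = INR (fact n).
Proof.
  induction n as [|n IH]; [exact GPi_0|].
  rewrite S_INR, GPi_succ, IH by apply pos_INR.
  rewrite fact_simpl, mult_INR, S_INR. reflexivity.
Qed.

Lemma GPi_nonneg (x : R) : 0 <= x -> 0 <= GPi x.
Proof.
  intro Hx. eapply Rle_trans; [apply Rabs_pos|].
  apply (RInt_gen_pos_le (gamma_kernel x) (gamma_kernel x) (GPi x) (GPi x));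
    try now apply is_gamma_integral.
  intros t _. split; [apply Rlt_le, gamma_kernel_pos | apply Rle_refl].
Qed.

(** * Growth of the ratio between [GPi] and Stirling's function *)

(** Convexity of [exp] along the chord from 0 to [v]: average the tangent
    inequalities at [s * v], in which the first-order terms cancel. *)
Lemma exp_convex (s v : R) : 0 <= s <= 1 -> exp (s * v) <= 1 - s + s * exp v.
Proof.
  intro Hs.
  assert (H0 : exp (s * v) * (1 - s * v) <= 1).
  { replace 1 with (exp (s * v) * exp (- (s * v))) at 2
      by (rewrite <- exp_plus, Rplus_opp_r; apply exp_0).
    apply Rmult_le_compat_l; [apply Rlt_le, exp_pos|].
    generalize (exp_ineq1_le (- (s * v))). lra. }
  assert (H1 : exp (s * v) * (1 + (1 - s) * v) <= exp v).
  { replace (exp v) with (exp (s * v) * exp ((1 - s) * v))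
      by (rewrite <- exp_plus; f_equal; ring).
    apply Rmult_le_compat_l; [apply Rlt_le, exp_pos|].
    apply exp_ineq1_le. }
  replace (exp (s * v)) with ((1 - s) * (exp (s * v) * (1 - s * v))
    + s * (exp (s * v) * (1 + (1 - s) * v))) by ring.
  apply Rplus_le_compat.
  - rewrite <- (Rmult_1_r (1 - s)) at 2. apply Rmult_le_compat_l; lra.
  - apply Rmult_le_compat_l; lra.
Qed.

(** Takes the place of logarithmic convexity: the concave function [t ^ s] lies below its
    tangent at [t = y], and integrating this tangent against
    [t ^ y * exp (- t)] only involves [GPi y] and [GPi (y + 1)]. *)
Lemma GPi_add_le (y s : R) : 0 < y -> 0 <= s <= 1 ->
  GPi (y + s) <= Rpower y s * (1 + s / y) * GPi y.
Proof.
  intros Hy Hs.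
  replace (Rpower y s * (1 + s / y) * GPi y)
    with (Rpower y s * (1 - s) * GPi y + Rpower y s * (s / y) * GPi (y + 1))
    by (rewrite GPi_succ by lra; field; lra).
  eapply Rle_trans; [apply Rle_abs|].
  apply (RInt_gen_pos_le (gamma_kernel (y + s))
    (fun t => Rpower y s * (1 - s) * gamma_kernel y t
              + Rpower y s * (s / y) * gamma_kernel (y + 1) t)).
  - intros t Ht. split; [apply Rlt_le, gamma_kernel_pos|].
    unfold gamma_kernel. rewrite !Rpower_plus, Rpower_1 by exact Ht.
    replace (Rpower t s) with (Rpower y s * exp (s * ln (t / y))).
    + assert (H := exp_convex s (ln (t / y)) Hs).
      rewrite exp_ln in H by (now apply Rdiv_lt_0_compat).
      assert (0 < Rpower t y * Rpower y s * exp (- t))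
        by (repeat apply Rmult_lt_0_compat; apply exp_pos).
      replace (Rpower t y * (Rpower y s * exp (s * ln (t / y))) * exp (- t))
        with (Rpower t y * Rpower y s * exp (- t) * exp (s * ln (t / y))) by ring.
      replace (Rpower y s * (1 - s) * (Rpower t y * exp (- t)) +
               Rpower y s * (s / y) * (Rpower t y * t * exp (- t)))
        with (Rpower t y * Rpower y s * exp (- t) * (1 - s + s * (t / y)))
        by (field; lra).
      apply Rmult_le_compat_l; lra.
    + unfold Rpower. rewrite <- exp_plus, ln_div by lra. f_equal. ring.
  - apply is_gamma_integral. lra.
  - apply (is_RInt_gen_plus (V := R_NormedModule)
      (fun t => Rpower y s * (1 - s) * gamma_kernel y t)
      (fun t => Rpower y s * (s / y) * gamma_kernel (y + 1) t)).
    + apply (is_RInt_gen_scal (V := R_NormedModule) (gamma_kernel y)).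
      apply is_gamma_integral. lra.
    + apply (is_RInt_gen_scal (V := R_NormedModule) (gamma_kernel (y + 1))).
      apply is_gamma_integral. lra.
Qed.

Lemma S_exp (d x : R) :
  S_ d x = exp (ln (sqrt (2 * PI)) - d + (x + 1 / 2) * ln (x + d) - x).
Proof.
  assert (0 < sqrt (2 * PI)) by (apply sqrt_lt_R0; generalize PI_RGT_0; lra).
  unfold S_, Rpower, Rminus. rewrite !exp_plus, exp_ln by assumption. reflexivity.
Qed.

Lemma S_pos (d x : R) : 0 < S_ d x.
Proof. rewrite S_exp. apply exp_pos. Qed.

(** The ratio is normalised by [S_ 0], for which both the step by 1 and the
    doubling [y -> 2 * y] give clean formulas. *)
Definition stirling_ratio (y : R) : R := GPi y / S_ 0 y.

Lemma stirling_ratio_nonneg (y : R) : 0 <= y -> 0 <= stirling_ratio y.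
Proof.
  intro Hy. apply Rmult_le_pos; [now apply GPi_nonneg|].
  apply Rlt_le, Rinv_0_lt_compat, S_pos.
Qed.

Lemma S_0_add_ge (y s : R) : 0 < y -> 0 <= s -> Rpower y s * S_ 0 y <= S_ 0 (y + s).
Proof.
  intros Hy Hs. rewrite !S_exp. unfold Rpower. rewrite <- exp_plus, !Rplus_0_r.
  apply exp_le.
  assert (H : s <= (y + s) * (ln (y + s) - ln y)).
  { assert (Hq : 0 < y / (y + s)) by (apply Rdiv_lt_0_compat; lra).
    assert (H := ln_le_sub_1 _ Hq). rewrite ln_div in H by lra.
    replace s with ((y + s) * (1 - y / (y + s))) at 1 by (field; lra).
    apply Rmult_le_compat_l; lra. }
  assert (ln y <= ln (y + s)) by (apply ln_le; lra).
  lra.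
Qed.

(** The ratio cannot rise by more than a factor [1 + s / y] over a step [s] of
    length at most 1, since [S_ 0] gains at least the factor [y ^ s] that
    [GPi_add_le] allows. Applied from [n] to [n + s] and from
    [n + s] to [n + 1], it pins the values between two integers. *)
Lemma stirling_ratio_add_le (y s : R) : 0 < y -> 0 <= s <= 1 ->
  stirling_ratio (y + s) <= (1 + s / y) * stirling_ratio y.
Proof.
  intros Hy Hs. unfold stirling_ratio.
  assert (H1 := GPi_add_le y s Hy Hs). assert (H2 := S_0_add_ge y s Hy (proj1 Hs)).
  assert (P1 := S_pos 0 y). assert (P2 := S_pos 0 (y + s)).
  assert (HG : 0 <= GPi y) by (apply GPi_nonneg; lra).
  assert (0 <= s / y) by (apply Rdiv_le_0_compat; lra).
  assert (Hk : 0 <= (1 + s / y) * (GPi y / S_ 0 y)).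
  { apply Rmult_le_pos; [lra | apply Rdiv_le_0_compat; lra]. }
  apply Rmult_le_reg_r with (S_ 0 (y + s)); [exact P2|].
  replace (GPi (y + s) / S_ 0 (y + s) * S_ 0 (y + s)) with (GPi (y + s)) by (field; lra).
  eapply Rle_trans; [exact H1|].
  replace (Rpower y s * (1 + s / y) * GPi y)
    with ((1 + s / y) * (GPi y / S_ 0 y) * (Rpower y s * S_ 0 y)) by (field; lra).
  now apply Rmult_le_compat_l.
Qed.

(** * The sawtooth integral *)

Lemma Int_part_cell (k : Z) (t : R) : IZR k <= t < IZR k + 1 -> Int_part t = k.
Proof. intro H. symmetry. apply Int_part_spec. lra. Qed.

Lemma frac_part_cell (k : Z) (t : R) : IZR k <= t < IZR k + 1 -> frac_part t = t - IZR k.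
Proof. intro H. unfold frac_part. now rewrite (Int_part_cell k t H). Qed.

(** Additive properties of intervals need only be checked on intervals between
    two consecutive integers, where the floor is constant. *)
Lemma interval_cell_ind (Q : R -> R -> Prop) (lo : R) :
  (forall (k : Z) a b, lo < a -> IZR k <= a <= b -> b <= IZR k + 1 -> Q a b) ->
  (forall a b c, lo < a <= b -> b <= c -> Q a b -> Q b c -> Q a c) ->
  forall a b, lo < a <= b -> Q a b.
Proof.
  intros Hcell Hcat.
  assert (H : forall (n : nat) (k : Z) a b, lo < a -> IZR k <= a <= b -> a <= IZR k + 1 ->
                b <= IZR k + 1 + INR n -> Q a b).
  { induction n as [|n IH]; intros k a b Hlo Hab Ha Hb.
    - apply (Hcell k); simpl in Hb; lra.
    - destruct (Rle_dec b (IZR k + 1)) as [Hk|Hk]; [now apply (Hcell k)|].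
      apply (Hcat a (IZR k + 1) b); try lra.
      + apply (Hcell k); lra.
      + apply (IH (k + 1)%Z); rewrite ?plus_IZR; try lra.
        rewrite S_INR in Hb. lra. }
  intros a b Hab. destruct (base_Int_part a) as [H1 H2].
  destruct (INR_unbounded (b - a)) as [n Hn].
  apply (H n (Int_part a)); lra.
Qed.

(** The continuous periodic primitive of [1 / 2 - frac_part t] that vanishes at
    the integers. *)
Definition hump (t : R) : R := frac_part t * (1 - frac_part t) / 2.

(** Holds at the right end of the cell too, because the primitive vanishes at
    integers; so the same formula serves on closed cells. *)
Lemma hump_cell (k : Z) (t : R) : IZR k <= t <= IZR k + 1 ->
  hump t = (t - IZR k) * (1 - (t - IZR k)) / 2.
Proof.
  intros [H1 [H2 | H2]]; unfold hump.
  - now rewrite (frac_part_cell k) by lra.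
  - rewrite (frac_part_cell (k + 1)) by (rewrite plus_IZR; lra).
    rewrite plus_IZR, H2. field.
Qed.

Lemma hump_bounds (t : R) : 0 <= hump t <= 1 / 8.
Proof.
  unfold hump. destruct (base_fp t) as [H1 H2]. split.
  - apply Rmult_le_pos; [apply Rmult_le_pos; lra | lra].
  - generalize (pow2_ge_0 (frac_part t - 1 / 2)). lra.
Qed.

Lemma saw_kernel_cell (k : Z) (x t : R) : IZR k <= t < IZR k + 1 ->
  saw_kernel x t = (IZR k + 1 / 2 - t) / (x + t).
Proof. intro H. unfold saw_kernel. rewrite (frac_part_cell k t H). f_equal. ring. Qed.

Lemma ex_saw_cell (k : Z) (x a b : R) : - x < a -> IZR k <= a <= b -> b <= IZR k + 1 ->
  ex_RInt (saw_kernel x) a b.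
Proof.
  intros Hx Ha Hb.
  apply (ex_RInt_ext (fun t => (IZR k + 1 / 2 - t) / (x + t))).
  - intros t Ht. rewrite Rmin_left, Rmax_right in Ht by lra.
    rewrite (saw_kernel_cell k); [reflexivity | lra].
  - apply (ex_RInt_continuous (fun t => (IZR k + 1 / 2 - t) / (x + t))).
    intros t Ht. rewrite Rmin_left in Ht by lra.
    apply (ex_derive_continuous (fun t => (IZR k + 1 / 2 - t) / (x + t))).
    auto_derive. lra.
Qed.

(** Integration by parts of the sawtooth kernel on one cell, with the constant of
    integration [- c] left free: [c = 0] and [c = 1 / 8] give the sign of the
    remaining integral and thus a lower and an upper bound. *)
Lemma is_RInt_hump (k : Z) (c x a b : R) :
  - x < a -> IZR k <= a <= b -> b <= IZR k + 1 ->
  is_RInt (fun t => (IZR k + 1 / 2 - t) / (x + t) - (hump t - c) / (x + t) ^ 2) a b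
    ((hump b - c) / (x + b) - (hump a - c) / (x + a)).
Proof.
  intros Hx Ha Hb.
  set (h := fun t => (t - IZR k) * (1 - (t - IZR k)) / 2).
  apply (is_RInt_ext
    (fun t => (IZR k + 1 / 2 - t) / (x + t) - (h t - c) / (x + t) ^ 2)).
  { intros t Ht. rewrite Rmin_left, Rmax_right in Ht by lra.
    unfold h. rewrite <- hump_cell by lra. reflexivity. }
  rewrite !(hump_cell k) by lra.
  apply (is_RInt_derive (fun t => (h t - c) / (x + t))).
  - intros t Ht. rewrite Rmin_left in Ht by lra. unfold h.
    auto_derive; [lra | field; lra].
  - intros t Ht. rewrite Rmin_left in Ht by lra. unfold h.
    apply (ex_derive_continuous (fun t => (IZR k + 1 / 2 - t) / (x + t) -
      ((t - IZR k) * (1 - (t - IZR k)) / 2 - c) / (x + t) ^ 2)).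
    auto_derive. repeat split; try lra. apply Rmult_integral_contrapositive; lra.
Qed.

(** Both bounds are differences of a function between the ends, hence add up over
    adjacent intervals; that is what lets them pass through
    [interval_cell_ind]. *)
Lemma saw_integral_hump (x a b : R) : - x < a <= b ->
  exists v, is_RInt (saw_kernel x) a b v /\
    hump b / (x + b) - hump a / (x + a) <= v
      <= (hump b - 1 / 8) / (x + b) - (hump a - 1 / 8) / (x + a).
Proof.
  revert a b. apply interval_cell_ind.
  - intros k a b Hx Ha Hb.
    destruct (ex_saw_cell k x a b Hx Ha Hb) as [v Hv]. exists v. split; [exact Hv|].
    assert (B : forall t, 0 <= hump t <= 1 / 8) by exact hump_bounds.
    split.
    + assert (H0 := is_RInt_hump k 0 x a b Hx Ha Hb). rewrite !Rminus_0_r in H0.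
      apply (is_RInt_le _ _ a b _ _ (proj2 Ha) H0 Hv).
      intros t Ht. rewrite (saw_kernel_cell k) by lra.
      assert (0 <= (hump t - 0) / (x + t) ^ 2); [|lra].
      apply Rdiv_le_0_compat; [generalize (B t); lra | apply pow_lt; lra].
    + assert (H0 := is_RInt_hump k (1 / 8) x a b Hx Ha Hb).
      apply (is_RInt_le _ _ a b _ _ (proj2 Ha) Hv H0).
      intros t Ht. rewrite (saw_kernel_cell k) by lra.
      assert (0 <= (1 / 8 - hump t) / (x + t) ^ 2).
      { apply Rdiv_le_0_compat; [generalize (B t); lra | apply pow_lt; lra]. }
      replace ((hump t - 1 / 8) / (x + t) ^ 2) with (- ((1 / 8 - hump t) / (x + t) ^ 2))
        by (field; lra).
      lra.
  - intros a b c Hab Hbc (v & Hv & Bv) (w & Hw & Bw).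
    exists (v + w). split; [now apply (is_RInt_Chasles _ a b c v w) | simpl in *; lra].
Qed.

Lemma ex_saw (x a b : R) : - x < a -> - x < b -> ex_RInt (saw_kernel x) a b.
Proof.
  intros Ha Hb. destruct (Rle_dec a b).
  - destruct (saw_integral_hump x a b) as (v & Hv & _); [lra | now exists v].
  - apply ex_RInt_swap.
    destruct (saw_integral_hump x b a) as (v & Hv & _); [lra | now exists v].
Qed.

Lemma RInt_saw_Chasles (x a b c : R) : - x < a -> - x < b -> - x < c ->
  RInt (saw_kernel x) a c = RInt (saw_kernel x) a b + RInt (saw_kernel x) b c.
Proof.
  intros Ha Hb Hc. symmetry.
  apply (RInt_Chasles (saw_kernel x)); now apply ex_saw.
Qed.

Lemma saw_integral_bound (x a b : R) : - x < a <= b ->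
  Rabs (RInt (saw_kernel x) a b) <= / (8 * (x + a)).
Proof.
  intro H. destruct (saw_integral_hump x a b H) as (v & Hv & Bv).
  rewrite (is_RInt_unique _ _ _ _ Hv).
  assert (Ba := hump_bounds a). assert (Bb := hump_bounds b).
  assert (Pa : 0 < / (x + a)) by (apply Rinv_0_lt_compat; lra).
  assert (Pb : 0 < / (x + b)) by (apply Rinv_0_lt_compat; lra).
  rewrite Rinv_mult. unfold Rdiv in Bv. apply Rabs_le. split; nra.
Qed.

(** Cauchy criterion: the tail from [u] on is at most [/ (8 * (x + u))]. *)
Lemma saw_integral_cvg (x a : R) : - x < a ->
  exists l, filterlim (fun T => RInt (saw_kernel x) a T) (Rbar_locally p_infty) (locally l).
Proof.
  intro Ha.
  apply (proj1 (filterlim_locally_cauchy (F := Rbar_locally p_infty)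
                  (fun T => RInt (saw_kernel x) a T))).
  intros [e He].
  assert (B : forall u v, Rmax a (/ e - x) < u <= v ->
    Rabs (RInt (saw_kernel x) a v - RInt (saw_kernel x) a u) < e).
  { intros u v Huv.
    assert (Hmax := Rmax_l a (/ e - x)). assert (Hmax' := Rmax_r a (/ e - x)).
    rewrite (RInt_saw_Chasles x a u v), Rplus_minus_l by lra.
    eapply Rle_lt_trans; [apply saw_integral_bound; lra|].
    assert (Hie : 0 < / e) by now apply Rinv_0_lt_compat.
    (* Beyond [/ e - x] already [/ (x + u) < e], before the factor 8. *)
    rewrite <- (Rinv_inv e). apply Rinv_lt_contravar.
    - apply Rmult_lt_0_compat; lra.
    - lra. }
  exists (fun T => Rmax a (/ e - x) < T). split.
  - exists (Rmax a (/ e - x)). now intros.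
  - intros u v Hu Hv.
    change (Rabs (RInt (saw_kernel x) a v - RInt (saw_kernel x) a u) < e).
    destruct (Rle_dec u v); [apply B; lra|].
    rewrite Rabs_minus_sym. apply B; lra.
Qed.

Lemma is_RInt_gen_at_point_lim (f : R -> R) (a l : R) :
  (forall T, a <= T -> ex_RInt f a T) ->
  filterlim (fun T => RInt f a T) (Rbar_locally p_infty) (locally l) ->
  is_RInt_gen f (at_point a) (Rbar_locally p_infty) l.
Proof.
  intros Hex Hl P HP. destruct (Hl P HP) as [M HM].
  apply (Filter_prod _ _ _ (fun u => u = a) (fun T => Rmax a M < T)).
  - reflexivity.
  - exists (Rmax a M). now intros.
  - intros u T -> HT. simpl.
    assert (H1 := Rmax_l a M). assert (H2 := Rmax_r a M).
    exists (RInt f a T). split.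
    + apply (RInt_correct f), Hex. lra.
    + apply HM. lra.
Qed.

Lemma ex_saw_infty (x a : R) : - x < a -> ex_RInt_infty (saw_kernel x) a.
Proof.
  intro Ha. destruct (saw_integral_cvg x a Ha) as [l Hl].
  exists l. apply is_RInt_gen_at_point_lim; [|exact Hl].
  intros T HT. apply ex_saw; lra.
Qed.

Lemma saw_infty_lim (x a : R) : - x < a ->
  filterlim (fun T => RInt (saw_kernel x) a T) (Rbar_locally p_infty)
    (locally (RInt_infty (saw_kernel x) a)).
Proof.
  intro Ha. destruct (saw_integral_cvg x a Ha) as [l Hl].
  replace (RInt_infty (saw_kernel x) a) with l; [exact Hl|].
  symmetry. apply (is_RInt_gen_unique (saw_kernel x)).
  apply is_RInt_gen_at_point_lim; [|exact Hl].
  intros T HT. apply ex_saw; lra.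
Qed.

Lemma saw_infty_Chasles (x a b : R) : - x < a -> - x < b ->
  RInt_infty (saw_kernel x) a = RInt (saw_kernel x) a b + RInt_infty (saw_kernel x) b.
Proof.
  intros Ha Hb. apply (is_RInt_gen_unique (saw_kernel x)).
  apply (is_RInt_gen_Chasles (saw_kernel x) b).
  - apply is_RInt_gen_at_point, (RInt_correct (saw_kernel x)). now apply ex_saw.
  - apply (RInt_gen_correct (saw_kernel x)). now apply ex_saw_infty.
Qed.

(** * Telescoping along the integers *)

(** The right-hand side is the logarithm of the factor by which [stirling_ratio]
    drops from [x + k] to [x + k + 1], see [stirling_ratio_succ]. *)
Lemma RInt_saw_unit_cell (k : Z) (x : R) : - x < IZR k ->
  RInt (saw_kernel x) (IZR k) (IZR k + 1)
    = (x + IZR k + 1 / 2) * (ln (x + IZR k + 1) - ln (x + IZR k)) - 1.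
Proof.
  intro Hx. apply is_RInt_unique.
  apply (is_RInt_ext (fun t => (IZR k + 1 / 2 - t) / (x + t))).
  { intros t Ht. rewrite Rmin_left, Rmax_right in Ht by lra.
    rewrite (saw_kernel_cell k); [reflexivity | lra]. }
  replace ((x + IZR k + 1 / 2) * (ln (x + IZR k + 1) - ln (x + IZR k)) - 1)
    with (minus ((x + IZR k + 1 / 2) * ln (x + (IZR k + 1)) - (IZR k + 1))
                ((x + IZR k + 1 / 2) * ln (x + IZR k) - IZR k)).
  - apply (is_RInt_derive (fun t => (x + IZR k + 1 / 2) * ln (x + t) - t)).
    + intros t Ht. rewrite Rmin_left in Ht by lra.
      auto_derive; [lra | field; lra].
    + intros t Ht. rewrite Rmin_left in Ht by lra.
      apply (ex_derive_continuous (fun t => (IZR k + 1 / 2 - t) / (x + t))).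
      auto_derive. lra.
  - unfold minus, plus, opp; simpl. rewrite <- Rplus_assoc. ring.
Qed.

Lemma stirling_ratio_succ (y : R) : 0 < y ->
  exp ((y + 1 / 2) * (ln (y + 1) - ln y) - 1) * stirling_ratio (y + 1) = stirling_ratio y.
Proof.
  intro Hy. unfold stirling_ratio. rewrite GPi_succ by lra.
  assert (E : S_ 0 (y + 1) =
    exp ((y + 1 / 2) * (ln (y + 1) - ln y) - 1) * exp (ln (y + 1)) * S_ 0 y).
  { rewrite !S_exp, !Rplus_0_r, <- !exp_plus. f_equal. ring. }
  rewrite exp_ln in E by lra.
  rewrite E. assert (P := S_pos 0 y).
  assert (Pe := exp_pos ((y + 1 / 2) * (ln (y + 1) - ln y) - 1)).
  field. lra.
Qed.

(** Telescoping of [stirling_ratio_succ] along unit cells. The cells start at 1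
    so that [x = 0] needs no special care. *)
Lemma stirling_ratio_saw (x : R) (n : nat) : 0 <= x ->
  exp (RInt (saw_kernel x) 1 (1 + INR n)) * stirling_ratio (x + 1 + INR n)
    = stirling_ratio (x + 1).
Proof.
  intro Hx. induction n as [|n IH].
  - simpl. rewrite !Rplus_0_r, RInt_point. change (@zero _) with 0.
    rewrite exp_0. ring.
  - assert (Hn := pos_INR n). rewrite <- IH, S_INR.
    rewrite <- (stirling_ratio_succ (x + 1 + INR n)) by lra.
    rewrite <- Rmult_assoc, <- exp_plus.
    replace (x + 1 + (INR n + 1)) with (x + 1 + INR n + 1) by ring.
    replace (1 + (INR n + 1)) with (1 + INR n + 1) by ring.
    f_equal. f_equal.
    rewrite (RInt_saw_Chasles x 1 (1 + INR n) (1 + INR n + 1)) by lra.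
    f_equal.
    assert (E : 1 + INR n = IZR (1 + Z.of_nat n)) by (rewrite plus_IZR, INR_IZR_INZ; ring).
    rewrite E, RInt_saw_unit_cell by (rewrite <- E; lra).
    rewrite <- E, <- Rplus_assoc. reflexivity.
Qed.

(** * Wallis integrals and Stirling's formula *)

Definition wallis (n : nat) : R := RInt (fun t => sin t ^ n) 0 (PI / 2).

Lemma is_RInt_wallis (n : nat) : is_RInt (fun t => sin t ^ n) 0 (PI / 2) (wallis n).
Proof.
  apply (RInt_correct (fun t => sin t ^ n)), (ex_RInt_continuous (fun t => sin t ^ n)).
  intros t _. apply (ex_derive_continuous (fun t => sin t ^ n)). auto_derive. exact I.
Qed.

(** The function [cos t * sin t ^ (n + 1)] vanishes at both ends of the interval,
    and its derivative combines [sin t ^ n] and [sin t ^ (n + 2)]. *)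
Lemma wallis_rec (n : nat) : (INR n + 2) * wallis (S (S n)) = (INR n + 1) * wallis n.
Proof.
  assert (H1 : is_RInt (fun t => (INR n + 2) * sin t ^ S (S n) - (INR n + 1) * sin t ^ n)
                 0 (PI / 2) ((INR n + 2) * wallis (S (S n)) - (INR n + 1) * wallis n)).
  { apply (is_RInt_minus (V := R_NormedModule) (fun t => (INR n + 2) * sin t ^ S (S n))
             (fun t => (INR n + 1) * sin t ^ n)).
    - apply (is_RInt_scal (V := R_NormedModule) (fun t => sin t ^ S (S n))).
      apply is_RInt_wallis.
    - apply (is_RInt_scal (V := R_NormedModule) (fun t => sin t ^ n)).
      apply is_RInt_wallis. }
  assert (H2 : is_RInt (fun t => (INR n + 2) * sin t ^ S (S n) - (INR n + 1) * sin t ^ n)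
                 0 (PI / 2) (minus (- (cos (PI / 2) * sin (PI / 2) ^ S n))
                               (- (cos 0 * sin 0 ^ S n)))).
  { apply (is_RInt_derive (fun t => - (cos t * sin t ^ S n))).
    - intros t _. auto_derive; [exact I|].
      assert (Hc : cos t * cos t = 1 - sin t * sin t)
        by (generalize (sin2_cos2 t); unfold Rsqr; lra).
      change (match n with 0%nat => 1 | S _ => INR n + 1 end) with (INR (S n)).
      rewrite S_INR. simpl pow.
      transitivity (sin t * (sin t * sin t ^ n) - (INR n + 1) * (cos t * cos t) * sin t ^ n);
        [ring | rewrite Hc; ring].
    - intros t _.
      apply (ex_derive_continuous
        (fun t => (INR n + 2) * sin t ^ S (S n) - (INR n + 1) * sin t ^ n)).
      auto_derive. exact I. }
  apply (is_RInt_unique (V := R_CompleteNormedModule)) in H1.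
  apply (is_RInt_unique (V := R_CompleteNormedModule)) in H2. rewrite H1 in H2.
  rewrite cos_PI2, sin_0 in H2. unfold minus, plus, opp in H2; simpl in H2. lra.
Qed.

Lemma wallis_0 : wallis 0 = PI / 2.
Proof.
  unfold wallis. simpl. rewrite RInt_const. unfold scal; simpl; unfold mult; simpl. ring.
Qed.

Lemma wallis_1 : wallis 1 = 1.
Proof.
  unfold wallis. apply is_RInt_unique.
  replace 1 with (minus (- cos (PI / 2)) (- cos 0)).
  - apply (is_RInt_derive (fun t => - cos t)).
    + intros t _. auto_derive; [exact I | ring].
    + intros t _. apply (ex_derive_continuous (fun t => sin t ^ 1)). auto_derive. exact I.
  - rewrite cos_PI2, cos_0. unfold minus, plus, opp; simpl. ring.
Qed.

Lemma is_RInt_zero (a b : R) : is_RInt (fun _ => 0) a b 0.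
Proof.
  replace (is_RInt (fun _ => 0) a b 0) with (is_RInt (fun _ => 0) a b (scal (b - a) 0)).
  - apply (is_RInt_const (V := R_NormedModule)).
  - f_equal. apply Rmult_0_r.
Qed.

Lemma wallis_decr (n : nat) : 0 <= wallis (S n) <= wallis n.
Proof.
  assert (HPI := PI2_RGT_0).
  assert (Hs : forall t, 0 < t < PI / 2 -> 0 <= sin t <= 1).
  { intros t Ht. split; [apply sin_ge_0; lra | apply SIN_bound]. }
  split.
  - apply (is_RInt_le (fun _ => 0) (fun t => sin t ^ S n) 0 (PI / 2)); [lra| | |].
    + apply is_RInt_zero.
    + apply is_RInt_wallis.
    + intros t Ht. apply pow_le, Hs, Ht.
  - apply (is_RInt_le (fun t => sin t ^ S n) (fun t => sin t ^ n) 0 (PI / 2));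
      try apply is_RInt_wallis; [lra|].
    intros t Ht. destruct (Hs t Ht). simpl.
    assert (0 <= sin t ^ n) by now apply pow_le. nra.
Qed.

Lemma wallis_mul_succ (n : nat) : (INR n + 1) * (wallis n * wallis (S n)) = PI / 2.
Proof.
  induction n as [|n IH].
  - rewrite wallis_0, wallis_1. simpl. ring.
  - rewrite S_INR. rewrite <- IH.
    transitivity (wallis (S n) * ((INR n + 2) * wallis (S (S n)))); [ring|].
    rewrite wallis_rec. ring.
Qed.

Lemma wallis_even (n : nat) :
  INR (fact n) ^ 2 * 4 ^ n * wallis (2 * n) = PI / 2 * INR (fact (2 * n)).
Proof.
  induction n as [|n IH].
  - simpl (2 * 0)%nat. rewrite wallis_0. simpl. ring.
  - replace (2 * S n)%nat with (S (S (2 * n))) by lia.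
    assert (Hn := pos_INR n).
    assert (E2 : INR (2 * n) = 2 * INR n) by (rewrite mult_INR; reflexivity).
    assert (R := wallis_rec (2 * n)). rewrite E2 in R.
    assert (Hw : wallis (S (S (2 * n))) =
      (2 * INR n + 1) / (2 * INR n + 2) * wallis (2 * n)).
    { apply Rmult_eq_reg_l with (2 * INR n + 2); [|lra].
      rewrite R. field. lra. }
    rewrite !fact_simpl, !mult_INR, !S_INR, E2.
    rewrite Hw. simpl (4 ^ S n).
    transitivity (2 * (INR n + 1) * (2 * INR n + 1)
                  * (INR (fact n) ^ 2 * 4 ^ n * wallis (2 * n))); [field; lra|].
    rewrite IH. ring.
Qed.

Lemma S_0_double (y : R) : 0 < y ->
  S_ 0 (2 * y) ^ 2 * (PI * y) = exp (4 * y * ln 2) * S_ 0 y ^ 4.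
Proof.
  intro Hy. assert (HPI := PI_RGT_0).
  rewrite !S_exp, !Rplus_0_r, ln_mult by lra.
  assert (E : ln (sqrt (2 * PI)) = (ln 2 + ln PI) / 2).
  { rewrite <- ln_mult, <- Rpower_sqrt by lra. unfold Rpower. rewrite ln_exp. field. }
  rewrite E.
  replace (PI * y) with (exp (ln PI + ln y))
    by (rewrite exp_plus, !exp_ln by lra; reflexivity).
  simpl pow. rewrite !Rmult_1_r, <- !exp_plus. f_equal. field.
Qed.

Lemma exp_4n_ln2 (n : nat) : exp (4 * INR n * ln 2) = (4 ^ n) ^ 2.
Proof.
  induction n as [|n IH].
  - simpl. rewrite Rmult_0_r, Rmult_0_l, exp_0. ring.
  - rewrite S_INR.
    replace (4 * (INR n + 1) * ln 2)
      with (4 * INR n * ln 2 + (ln 2 + ln 2 + ln 2 + ln 2)) by ring.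
    rewrite exp_plus, IH, !exp_plus, exp_ln by lra. simpl. ring.
Qed.

(** The fourth power clears the square roots in [S_0_double]; the factorials
    then combine into the central binomial coefficient, which [wallis_even]
    trades for a Wallis integral. *)
Lemma stirling_ratio_wallis (n : nat) :
  stirling_ratio (INR (S n)) ^ 4 * (4 * INR (S n) * wallis (2 * S n) ^ 2)
    = PI * stirling_ratio (INR (2 * S n)) ^ 2.
Proof.
  set (m := S n). unfold stirling_ratio. rewrite !GPi_INR.
  assert (HPI := PI_RGT_0).
  assert (Hm : 0 < INR m) by (apply lt_0_INR; unfold m; lia).
  assert (D := S_0_double (INR m) Hm). rewrite exp_4n_ln2 in D.
  assert (W := wallis_even m).
  assert (P1 := S_pos 0 (INR m)).
  replace (INR (2 * m)) with (2 * INR m) by (rewrite mult_INR; reflexivity).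
  assert (P2 := S_pos 0 (2 * INR m)).
  set (s := S_ 0 (INR m)) in *. set (s2 := S_ 0 (2 * INR m)) in *.
  set (f := INR (fact m)) in *. set (f2 := INR (fact (2 * m))) in *.
  set (w := wallis (2 * m)) in *. set (p := 4 ^ m) in *.
  assert (W2 : f ^ 4 * p ^ 2 * w ^ 2 = PI ^ 2 / 4 * f2 ^ 2).
  { transitivity ((f ^ 2 * p * w) ^ 2); [ring | rewrite W; field]. }
  assert (Pp : 0 < p) by (apply pow_lt; lra).
  apply Rmult_eq_reg_r with (p ^ 2 * s ^ 4 * s2 ^ 2).
  2:{ apply Rgt_not_eq, Rlt_gt. assert (0 < p ^ 2) by now apply pow_lt.
      assert (0 < s ^ 4) by now apply pow_lt. assert (0 < s2 ^ 2) by now apply pow_lt.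
      apply Rmult_lt_0_compat; [now apply Rmult_lt_0_compat | assumption]. }
  transitivity (4 * INR m * s2 ^ 2 * (f ^ 4 * p ^ 2 * w ^ 2)); [field; lra|].
  rewrite W2.
  transitivity (PI * f2 ^ 2 * (s2 ^ 2 * (PI * INR m))); [field|].
  rewrite D. field. lra.
Qed.

(** Since the Wallis integrals decrease, [wallis (2 * m) ^ 2] lies between the
    products with the next and with the previous one, both of which are
    explicit by [wallis_mul_succ]. *)
Lemma stirling_ratio_double_bounds (n : nat) :
  stirling_ratio (INR (2 * S n)) ^ 2 <= stirling_ratio (INR (S n)) ^ 4
    <= (1 + / INR (S n)) * stirling_ratio (INR (2 * S n)) ^ 2.
Proof.
  assert (E := stirling_ratio_wallis n).
  assert (HPI := PI_RGT_0).
  assert (W1 := wallis_mul_succ (S (2 * n))). assert (W2 := wallis_mul_succ (2 * S n)).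
  assert (D1 := wallis_decr (S (2 * n))). assert (D2 := wallis_decr (2 * S n)).
  replace (S (S (2 * n))) with (2 * S n)%nat in * by lia.
  replace (INR (S (2 * n)) + 1) with (2 * INR (S n)) in W1
    by (rewrite !S_INR, mult_INR; simpl; ring).
  replace (INR (2 * S n) + 1) with (2 * INR (S n) + 1) in W2
    by (rewrite mult_INR; reflexivity).
  assert (Hm : 0 < INR (S n)) by (apply lt_0_INR; lia).
  set (m := INR (S n)) in *. set (w := wallis (2 * S n)) in *.
  set (r4 := stirling_ratio m ^ 4) in *.
  set (r2 := stirling_ratio (INR (2 * S n)) ^ 2) in *.
  assert (0 <= r4).
  { unfold r4. replace (stirling_ratio m ^ 4) with ((stirling_ratio m ^ 2) ^ 2) by ring.
    apply pow2_ge_0. }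
  assert (B1 : 4 * m * w ^ 2 <= PI).
  { assert (w * w <= wallis (S (2 * n)) * w) by (apply Rmult_le_compat_r; lra). nra. }
  assert (B2 : m * PI <= (m + 1) * (4 * m * w ^ 2)).
  { assert (w * wallis (S (2 * S n)) <= w * w) by (apply Rmult_le_compat_l; lra).
    assert (PI / 2 <= (2 * m + 1) * w ^ 2) by (rewrite <- W2; nra).
    assert (0 <= w ^ 2) by apply pow2_ge_0.
    nra. }
  split.
  - apply Rmult_le_reg_l with PI; [exact HPI|]. rewrite <- E, (Rmult_comm PI).
    now apply Rmult_le_compat_l.
  - apply Rmult_le_reg_l with (m * PI); [now apply Rmult_lt_0_compat|].
    replace (m * PI * ((1 + / m) * r2)) with ((m + 1) * (PI * r2)) by (field; lra).
    rewrite <- E.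
    replace ((m + 1) * (r4 * (4 * m * w ^ 2))) with (r4 * ((m + 1) * (4 * m * w ^ 2))) by ring.
    rewrite (Rmult_comm (m * PI)). now apply Rmult_le_compat_l.
Qed.

Lemma saw_infty_lim_seq (x : R) : 0 <= x ->
  is_lim_seq (fun n => RInt (saw_kernel x) 1 (1 + INR n)) (RInt_infty (saw_kernel x) 1).
Proof.
  intro Hx. unfold is_lim_seq.
  apply (filterlim_comp _ _ _ (fun n => 1 + INR n) (fun T => RInt (saw_kernel x) 1 T)
           eventually (Rbar_locally p_infty)).
  - change (is_lim_seq (fun n => 1 + INR n) p_infty).
    apply (is_lim_seq_ext (fun n => INR (S n))).
    + intro n. rewrite S_INR. ring.
    + apply (is_lim_seq_incr_1 INR), is_lim_seq_INR.
  - apply saw_infty_lim. lra.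
Qed.

Lemma is_lim_seq_inv_INR : is_lim_seq (fun n => / INR (S n)) 0.
Proof.
  apply (is_lim_seq_incr_1 (fun n => / INR n)).
  replace (Finite 0) with (Rbar_inv p_infty) by reflexivity.
  apply is_lim_seq_inv; [apply is_lim_seq_INR | discriminate].
Qed.

(** The limit [K] exists and is positive because the sawtooth integral for
    [x = 0] converges; comparing the ratios at [n] and [2 * n] gives
    [K ^ 2 = K ^ 4]. *)
Lemma stirling_factorial : is_lim_seq (fun n => stirling_ratio (INR n)) 1.
Proof.
  set (K := exp (- RInt_infty (saw_kernel 0) 1) * stirling_ratio 1).
  assert (HK : is_lim_seq (fun n => stirling_ratio (INR n)) K).
  { apply is_lim_seq_incr_1.
    apply (is_lim_seq_ext
      (fun n => exp (- RInt (saw_kernel 0) 1 (1 + INR n)) * stirling_ratio 1)).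
    - intro n. replace (stirling_ratio 1) with (stirling_ratio (0 + 1)) by (f_equal; ring).
      rewrite <- (stirling_ratio_saw 0 n) by lra.
      rewrite <- Rmult_assoc, <- exp_plus, Rplus_opp_l, exp_0, S_INR.
      replace (0 + 1 + INR n) with (INR n + 1) by ring. ring.
    - apply is_lim_seq_mult'; [|apply is_lim_seq_const].
      apply is_lim_seq_continuous.
      + apply continuity_pt_filterlim. apply (ex_derive_continuous exp).
        auto_derive. exact I.
      + apply (is_lim_seq_opp _ (RInt_infty (saw_kernel 0) 1)), saw_infty_lim_seq. lra. }
  assert (PK : 0 < K).
  { apply Rmult_lt_0_compat; [apply exp_pos|]. unfold stirling_ratio.
    change 1 with (INR 1) at 1. rewrite GPi_INR. simpl.
    apply Rdiv_lt_0_compat; [lra | apply S_pos]. }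
  assert (H1 : is_lim_seq (fun n => stirling_ratio (INR (S n)) ^ 4) (K ^ 4)).
  { assert (H := proj1 (is_lim_seq_incr_1 (fun n => stirling_ratio (INR n)) K) HK).
    cbn [pow]. do 4 (apply is_lim_seq_mult'; [exact H|]). apply is_lim_seq_const. }
  assert (H2 : is_lim_seq (fun n => stirling_ratio (INR (2 * S n)) ^ 2) (K ^ 2)).
  { assert (H : is_lim_seq (fun n => stirling_ratio (INR (2 * S n))) K).
    { apply (is_lim_seq_subseq (fun n => stirling_ratio (INR n)) K (fun n => 2 * S n)%nat).
      - apply eventually_subseq. intro n. lia.
      - exact HK. }
    cbn [pow]. do 2 (apply is_lim_seq_mult'; [exact H|]). apply is_lim_seq_const. }
  assert (H3 : is_lim_seq (fun n => (1 + / INR (S n)) * stirling_ratio (INR (2 * S n)) ^ 2)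
                 ((1 + 0) * K ^ 2)).
  { apply is_lim_seq_mult'; [|exact H2].
    apply is_lim_seq_plus'; [apply is_lim_seq_const | apply is_lim_seq_inv_INR]. }
  assert (L1 := is_lim_seq_le _ _ _ _
    (fun n => proj1 (stirling_ratio_double_bounds n)) H2 H1).
  assert (L2 := is_lim_seq_le _ _ _ _
    (fun n => proj2 (stirling_ratio_double_bounds n)) H1 H3).
  simpl in L1, L2.
  replace 1 with K; [exact HK|].
  assert (HK2 : K * K = 1).
  { apply Rmult_eq_reg_l with (K * K); [nra | nra]. }
  nra.
Qed.

(** The bounds of [stirling_ratio_add_le] squeeze the values at [n + s], for
    [s] in the unit interval, between those at the integers; any [x] is an
    integer plus such an [s]. *)
Lemma stirling_GPi (x : R) : 0 <= x ->
  is_lim_seq (fun n => stirling_ratio (x + INR n)) 1.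
Proof.
  intro Hx.
  assert (H : forall s, 0 <= s <= 1 -> is_lim_seq (fun n => stirling_ratio (INR n + s)) 1).
  { intros s Hs. apply is_lim_seq_incr_1.
    apply (is_lim_seq_le_le (fun n => (1 - / INR (S n)) * stirling_ratio (INR (S (S n)))) _
             (fun n => (1 + / INR (S n)) * stirling_ratio (INR (S n)))).
    - intro n. assert (Hm : 1 <= INR (S n)) by (rewrite S_INR; generalize (pos_INR n); lra).
      set (m := INR (S n)) in *.
      assert (Hi : 0 < / m <= 1).
      { split; [apply Rinv_0_lt_compat; lra|].
        rewrite <- Rinv_1. apply Rinv_le_contravar; lra. }
      assert (Hle : forall u y, 0 <= u <= 1 -> m <= y -> u / y <= / m).
      { intros u y Hu Hy. apply Rle_trans with (1 * / m); [|lra].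
        apply Rmult_le_compat; try lra.
        - apply Rlt_le, Rinv_0_lt_compat; lra.
        - apply Rinv_le_contravar; lra. }
      split.
      (* Here [(1 - / m) * (1 + / m) <= 1] spares the inverse of [1 + / m]. *)
      + assert (A := stirling_ratio_add_le (m + s) (1 - s) ltac:(lra) ltac:(lra)).
        replace (m + s + (1 - s)) with (INR (S (S n))) in A
          by (rewrite (S_INR (S n)); fold m; ring).
        assert (B := Hle (1 - s) (m + s) ltac:(lra) ltac:(lra)).
        assert (C := stirling_ratio_nonneg (m + s) ltac:(lra)).
        apply Rle_trans with ((1 - / m) * ((1 + / m) * stirling_ratio (m + s))).
        * apply Rmult_le_compat_l; [lra|]. eapply Rle_trans; [exact A|].
          apply Rmult_le_compat_r; lra.
        * nra.
      + assert (A := stirling_ratio_add_le m s ltac:(lra) Hs).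
        assert (B := Hle s m Hs (Rle_refl m)).
        assert (C := stirling_ratio_nonneg m ltac:(lra)).
        eapply Rle_trans; [exact A|]. apply Rmult_le_compat_r; lra.
    - replace (Finite 1) with (Finite ((1 - 0) * 1)) by (f_equal; ring).
      apply is_lim_seq_mult'.
      + apply is_lim_seq_minus'; [apply is_lim_seq_const | apply is_lim_seq_inv_INR].
      + assert (F := stirling_factorial).
        apply (is_lim_seq_incr_n (fun n => stirling_ratio (INR n)) 2) in F.
        eapply is_lim_seq_ext; [|exact F]. intro n. cbv beta. do 2 f_equal. lia.
    - replace (Finite 1) with (Finite ((1 + 0) * 1)) by (f_equal; ring).
      apply is_lim_seq_mult'.
      + apply is_lim_seq_plus'; [apply is_lim_seq_const | apply is_lim_seq_inv_INR].
      + apply (is_lim_seq_incr_1 (fun n => stirling_ratio (INR n))), stirling_factorial. }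
  destruct (base_fp x) as [F0 F1].
  assert (HI : (0 <= Int_part x)%Z).
  { apply Z.lt_succ_r, lt_IZR. rewrite succ_IZR. destruct (base_Int_part x). lra. }
  specialize (H (frac_part x) (conj (Rge_le _ _ F0) (Rlt_le _ _ F1))).
  apply (is_lim_seq_incr_n _ (Z.to_nat (Int_part x))) in H.
  eapply is_lim_seq_ext; [|exact H]. intro n. simpl. f_equal.
  rewrite plus_INR, (INR_IZR_INZ (Z.to_nat _)), Z2Nat.id by exact HI.
  unfold frac_part. ring.
Qed.

(** The case [d = 1], in which the shift by [d] turns into the functional equation:
    [GPi x / S_ 1 x] is the ratio [GPi / S_ 0] at [x + 1]. *)
Lemma GPi_div_S_1 (x : R) : 0 <= x -> GPi x / S_ 1 x = exp (RInt_infty (saw_kernel x) 1).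
Proof.
  intro Hx.
  assert (E : GPi x / S_ 1 x = stirling_ratio (x + 1)).
  { unfold stirling_ratio. rewrite GPi_succ by exact Hx.
    assert (D : S_ 0 (x + 1) = exp (ln (x + 1)) * S_ 1 x).
    { rewrite !S_exp, <- exp_plus, !Rplus_0_r. f_equal. ring. }
    rewrite exp_ln in D by lra. rewrite D. assert (P := S_pos 1 x). field. lra. }
  rewrite E.
  assert (L : is_lim_seq (fun n => exp (RInt (saw_kernel x) 1 (1 + INR n))
                * stirling_ratio (x + 1 + INR n)) (exp (RInt_infty (saw_kernel x) 1) * 1)).
  { apply is_lim_seq_mult'; [|apply stirling_GPi; lra].
    apply is_lim_seq_continuous; [|now apply saw_infty_lim_seq].
    apply continuity_pt_filterlim. apply (ex_derive_continuous exp). auto_derive. exact I. }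
  apply (is_lim_seq_ext _ (fun _ => stirling_ratio (x + 1))) in L.
  - assert (L' := is_lim_seq_const (stirling_ratio (x + 1))).
    apply is_lim_seq_unique in L. apply is_lim_seq_unique in L'.
    rewrite L in L'. injection L'. lra.
  - intro n. now apply stirling_ratio_saw.
Qed.

(** * Arbitrary [d] *)

Lemma is_RInt_lin (x a b : R) : - x < a -> - x < b ->
  is_RInt (lin_kernel x) a b ((b - a) - (x + 1 / 2) * (ln (x + b) - ln (x + a))).
Proof.
  intros Ha Hb.
  assert (Hmin : - x < Rmin a b) by now apply Rmin_glb_lt.
  replace ((b - a) - (x + 1 / 2) * (ln (x + b) - ln (x + a)))
    with (minus (b - (x + 1 / 2) * ln (x + b)) (a - (x + 1 / 2) * ln (x + a)))
    by (unfold minus, plus, opp; simpl; ring).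
  apply (is_RInt_derive (fun t => t - (x + 1 / 2) * ln (x + t))); unfold lin_kernel.
  - intros t Ht. auto_derive; [lra | field; lra].
  - intros t Ht. apply (ex_derive_continuous (fun t => (t - 1 / 2) / (x + t))).
    auto_derive. lra.
Qed.

(** The linear kernel is the logarithmic derivative, up to sign, of [S_ d x]
    with respect to [d]. *)
Lemma S_1_eq_S_lin (d x : R) : 0 <= x -> - d < x ->
  S_ 1 x = S_ d x * exp (RInt (lin_kernel x) 1 d).
Proof.
  intros Hx Hd. rewrite (is_RInt_unique _ _ _ _ (is_RInt_lin x 1 d ltac:(lra) ltac:(lra))).
  rewrite !S_exp, <- exp_plus, (Rplus_comm x d), (Rplus_comm d x). f_equal. ring.
Qed.

Lemma is_RInt_floor (x a b : R) : - x < a -> - x < b ->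
  is_RInt (floor_kernel x) a b (RInt (saw_kernel x) a b + RInt (lin_kernel x) a b).
Proof.
  intros Ha Hb.
  assert (E : forall t, saw_kernel x t + lin_kernel x t = floor_kernel x t).
  { intro t. unfold saw_kernel, lin_kernel, floor_kernel, frac_part, Rdiv. ring. }
  apply (is_RInt_ext (fun t => saw_kernel x t + lin_kernel x t)); [intros; apply E|].
  apply (is_RInt_plus (V := R_NormedModule) (saw_kernel x) (lin_kernel x)).
  - apply (RInt_correct (saw_kernel x)). now apply ex_saw.
  - apply (RInt_correct (lin_kernel x)). eexists. now apply is_RInt_lin.
Qed.

Lemma is_RInt_floor_0 (x c : R) : 0 <= c <= 1 -> is_RInt (floor_kernel x) c 1 0.
Proof.
  intro Hc. apply (is_RInt_ext (fun _ => 0)).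
  - intros t Ht. rewrite Rmin_left, Rmax_right in Ht by lra.
    unfold floor_kernel. rewrite (Int_part_cell 0) by (simpl; lra). cbv beta. symmetry. apply Rmult_0_l.
  - apply is_RInt_zero.
Qed.

Theorem theorem13 :
  (forall d x c : R, 0 <= x -> - d < x -> 0 <= c <= 1 ->
     ex_RInt_infty (saw_kernel x) (1 / 2) /\
     ex_RInt (lin_kernel x) (1 / 2) d /\
     ex_RInt_infty (saw_kernel x) d /\
     ex_RInt (floor_kernel x) c d /\
     GPi x / S_ d x =
       exp (RInt_infty (saw_kernel x) (1 / 2) + RInt (lin_kernel x) (1 / 2) d) /\
     GPi x / S_ d x =
       exp (RInt_infty (saw_kernel x) d + RInt (floor_kernel x) c d)) /\
  (forall d x : R, 0 <= d <= 1 -> 0 <= x -> - d < x ->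
     ex_RInt_infty (saw_kernel x) d /\
     GPi x / S_ d x = exp (RInt_infty (saw_kernel x) d)).
Proof.
  assert (Base : forall d x, 0 <= x -> - d < x ->
    GPi x / S_ d x = exp (RInt_infty (saw_kernel x) 1 + RInt (lin_kernel x) 1 d)).
  { intros d x Hx Hd. rewrite exp_plus, <- GPi_div_S_1, (S_1_eq_S_lin d x Hx Hd) by exact Hx.
    assert (P := S_pos d x). assert (Pe := exp_pos (RInt (lin_kernel x) 1 d)).
    field. lra. }
  assert (Floor : forall d x c, 0 <= x -> - d < x -> 0 <= c <= 1 ->
    is_RInt (floor_kernel x) c d (RInt (saw_kernel x) 1 d + RInt (lin_kernel x) 1 d)).
  { intros d x c Hx Hd Hc.
    replace (RInt (saw_kernel x) 1 d + RInt (lin_kernel x) 1 d)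
      with (plus 0 (RInt (saw_kernel x) 1 d + RInt (lin_kernel x) 1 d))
      by apply (plus_zero_l (G := R_AbelianMonoid)).
    apply (is_RInt_Chasles (V := R_NormedModule) (floor_kernel x) c 1 d).
    - now apply is_RInt_floor_0.
    - apply is_RInt_floor; lra. }
  assert (Second : forall d x c, 0 <= x -> - d < x -> 0 <= c <= 1 ->
    GPi x / S_ d x = exp (RInt_infty (saw_kernel x) d + RInt (floor_kernel x) c d)).
  { intros d x c Hx Hd Hc. rewrite (Base d x Hx Hd). f_equal.
    rewrite (is_RInt_unique _ _ _ _ (Floor d x c Hx Hd Hc)).
    rewrite (saw_infty_Chasles x 1 d) by lra. simpl. lra. }
  split.
  - intros d x c Hx Hd Hc. repeat split.
    + apply ex_saw_infty. lra.
    + eexists. apply is_RInt_lin; lra.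
    + apply ex_saw_infty. lra.
    + eexists. now apply Floor.
    (* Between 1/2 and 1 the floor vanishes: sawtooth and linear kernel cancel. *)
    + rewrite (Base d x Hx Hd). f_equal.
      rewrite (saw_infty_Chasles x (1 / 2) 1) by lra.
      assert (Z := is_RInt_unique _ _ _ _ (is_RInt_floor x (1 / 2) 1 ltac:(lra) ltac:(lra))).
      rewrite (is_RInt_unique _ _ _ _ (is_RInt_floor_0 x (1 / 2) ltac:(lra))) in Z.
      rewrite (is_RInt_unique _ _ _ _ (is_RInt_lin x (1 / 2) 1 ltac:(lra) ltac:(lra))) in Z.
      rewrite (is_RInt_unique _ _ _ _ (is_RInt_lin x 1 d ltac:(lra) ltac:(lra))).
      rewrite (is_RInt_unique _ _ _ _ (is_RInt_lin x (1 / 2) d ltac:(lra) ltac:(lra))).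
      lra.
    + now apply Second.
  - intros d x Hd Hx Hdx. split.
    + apply ex_saw_infty. lra.
    (* The choice [c = d] makes the floor integral empty. *)
    + rewrite (Second d x d Hx Hdx Hd), RInt_point.
      f_equal. apply Rplus_0_r.
Qed.
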